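(* Let $\mathbb{L}$ be a lattice that is (isomorphic to) the congruence lattice of some finite expanded group. Then the following are equivalent: (1) $\mathbb{L}$ forces nilpotency in the class of finite expanded groups. (2) Every finite expanded group $\mathbf{B}$ with $\mathrm{Con}(\mathbf{B}) \cong \mathbb{L}$ is nilpotent. (3) For each prime interval $I[\alpha,\beta]$ of $\mathbb{L}$, we have $\boldsymbol{\Gamma}(\alpha,\beta) = 1$.
   Context: An expanded group is an algebra having the operations of a group (written $+,-,0$, not necessarily commutative) among its fundamental operations, possibly together with further operations. For a class $K$ of algebras and a property $p$ of algebras, a lattice $\mathbb{L}$ forces $p$ in $K$ if every $\mathbf{A}\in K$ with $\mathrm{Con}(\mathbf{A})\cong\mathbb{L}$ has property $p$. Commutator: for congruences $\alpha,\beta$ of an algebra $\mathbf{A}$, $[\alpha,\beta]_{\mathbf{A}}$ is the intersection of all congruences $\delta$ of $\mathbf{A}$ such that for all $n\in\mathbb{N}$, all $(n+1)$-ary term functions $t$ of $\mathbf{A}$, all $(a,b)\in\alpha$ and all $(c_1,d_1),\dots,(c_n,d_n)\in\beta$: if $(t(a,c_1,\dots,c_n),t(a,d_1,\dots,d_n))\in\delta$ then $(t(b,c_1,\dots,c_n),t(b,d_1,\dots,d_n))\in\delta$. $\mathbf{A}$ is nilpotent if the lower central series $\lambda_1=1_A$, $\lambda_{n+1}=[1_A,\lambda_n]_{\mathbf{A}}$ satisfies $\lambda_k=0_A$ for some $k\in\mathbb{N}$, where $0_A,1_A$ are the least and greatest congruences. Lattice notions, for a complete lattice $\mathbb{L}$: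 $I[\alpha,\beta]$ is a prime interval (written $\alpha\prec\beta$) if $\alpha<\beta$ and $\{x : \alpha\le x\le\beta\}=\{\alpha,\beta\}$. An element $\eta$ is meet irreducible if $\eta<\eta^+:=\bigwedge\{\beta : \eta<\beta\}$; $M(\mathbb{L})$ is the set of meet irreducible elements. Write $I[\alpha,\beta]\nearrow I[\gamma,\delta]$ if $\delta=\beta\vee\gamma$ and $\alpha=\beta\wedge\gamma$; projectivity $\leftrightsquigarrow$ is the smallest equivalence relation on intervals containing $\nearrow$. For $\alpha\prec\beta$, $\boldsymbol{\Gamma}(\alpha,\beta):=\bigvee\{\eta\in M(\mathbb{L}) : I[\eta,\eta^+]\leftrightsquigarrow I[\alpha,\beta]\}$. *)

(* Defs.v *)
From HB Require Import structures.
From mathcomp Require Import all_boot all_order.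
From mathcomp Require Import boolp.

Set Implicit Arguments.
Unset Strict Implicit.
Unset Printing Implicit Defensive.

Import Order.TTheory.
Local Open Scope order_scope.

(* An algebra on a finite carrier.  The fundamental operations are grouped by
   arity: [sym n] is the (possibly infinite) type of [n]-ary operation
   symbols. *)
Record finAlgebra := FinAlgebra {
  carrier :> finType;
  sym : nat -> Type;
  op : forall n, sym n -> n.-tuple carrier -> carrier
}.
Arguments op A {n} f x : rename.

Definition group_operations (T : Type) (add : T -> T -> T) (opp : T -> T)
    (zero : T) : Prop :=
  [/\ associative add,
      left_id zero add, right_id zero add,
      left_inverse zero opp add & right_inverse zero opp add].

Definition expanded_group (A : finAlgebra) : Prop :=
  exists (add : sym A 2) (opp : sym A 1) (zero : sym A 0),
    group_operations (fun x y => op A add [tuple x; y])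
                     (fun x => op A opp [tuple x])
                     (op A zero [tuple]).

(* [n]-ary terms; the [n]-ary term functions of [A] are the functions
   [eval t] for [t : term A n]. *)
Inductive term (A : finAlgebra) (n : nat) : Type :=
  | Var of 'I_n
  | App m of sym A m & ('I_m -> term A n).

Fixpoint eval (A : finAlgebra) (n : nat) (t : term A n)
    (v : n.-tuple A) : A :=
  match t with
  | Var i => tnth v i
  | App m f ts => op A f [tuple eval (ts i) v | i < m]
  end.

Definition is_congruence (A : finAlgebra) (r : {set A * A}) : Prop :=
  [/\ forall x, (x, x) \in r,
      forall x y, (x, y) \in r -> (y, x) \in r,
      forall x y z, (x, y) \in r -> (y, z) \in r -> (x, z) \in r &
      forall n (f : sym A n) (s t : n.-tuple A),
        (forall i, (tnth s i, tnth t i) \in r) ->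
        (op A f s, op A f t) \in r].

Record con (A : finAlgebra) := Con {
  con_set :> {set A * A};
  con_setP : `[< is_congruence con_set >]
}.

HB.instance Definition _ (A : finAlgebra) := [isSub for @con_set A].
HB.instance Definition _ (A : finAlgebra) := [Finite of con A by <:].

Lemma conP (A : finAlgebra) (a : con A) : is_congruence a.
Proof. exact/asboolP/con_setP. Qed.

Lemma con_meet_subproof (A : finAlgebra) (P : pred (con A)) :
  `[< is_congruence (\bigcap_(c : con A | P c) con_set c) >].
Proof.
apply/asboolP; split.
- by move=> x; apply/bigcapP => c _; have [+ _ _ _] := conP c; apply.
- move=> x y /bigcapP xy; apply/bigcapP => c Pc.
  by have [_ + _ _] := conP c; apply; apply: xy.
- move=> x y z /bigcapP xy /bigcapP yz; apply/bigcapP => c Pc.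
  by have [_ _ + _] := conP c; apply; [apply: xy | apply: yz].
- move=> n f s t st; apply/bigcapP => c Pc.
  have [_ _ _ +] := conP c; apply => i.
  by have /bigcapP := st i; apply.
Qed.

Definition con_inter (A : finAlgebra) (P : pred (con A)) : con A :=
  Con (con_meet_subproof P).

Definition con_le (A : finAlgebra) : rel (con A) :=
  fun a b => con_set a \subset con_set b.
Definition con_meet (A : finAlgebra) (a b : con A) : con A :=
  con_inter [pred c | (c == a) || (c == b)].
Definition con_join (A : finAlgebra) (a b : con A) : con A :=
  con_inter [pred c | con_le a c && con_le b c].
Definition con_bottom (A : finAlgebra) : con A := con_inter xpredT.
Definition con_top (A : finAlgebra) : con A := con_inter xpred0.

Section ConLattice.
Variable A : finAlgebra.
Implicit Types (a b c : con A) (P : pred (con A)).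

Lemma con_le_refl : reflexive (@con_le A).
Proof. by move=> a; apply: subxx. Qed.

Lemma con_le_anti : antisymmetric (@con_le A).
Proof.
move=> a b /andP[ab ba]; apply/val_inj/eqP.
by rewrite eqEsubset; apply/andP; split.
Qed.

Lemma con_le_trans : transitive (@con_le A).
Proof. by move=> b a c; apply: subset_trans. Qed.

Lemma con_le_inter a P :
  reflect (forall c, P c -> con_le a c) (con_le a (con_inter P)).
Proof. exact: bigcapsP. Qed.

Lemma con_inter_le a P : P a -> con_le (con_inter P) a.
Proof. by move=> Pa; apply: bigcap_inf. Qed.

Lemma con_meetP a b c : con_le a (con_meet b c) = con_le a b && con_le a c.
Proof.
apply/con_le_inter/andP => [h|[ab ac] d /orP[]/eqP-> //].
by split; apply: h; rewrite /= eqxx ?orbT.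
Qed.

Lemma con_joinP a b c : con_le (con_join a b) c = con_le a c && con_le b c.
Proof.
apply/idP/idP => [h|]; last exact: con_inter_le.
by apply/andP; split; apply: con_le_trans h; apply/con_le_inter => d /andP[].
Qed.

Lemma con_bottomP a : con_le (con_bottom A) a.
Proof. exact: con_inter_le. Qed.

Lemma con_topP a : con_le a (con_top A).
Proof. exact/con_le_inter. Qed.

End ConLattice.

Fact con_display : Order.disp_t. Proof. exact: Order.Disp tt tt. Qed.

HB.instance Definition _ (A : finAlgebra) :=
  Order.Le_isPOrder.Build con_display (con A)
    (@con_le_refl A) (@con_le_anti A) (@con_le_trans A).
HB.instance Definition _ (A : finAlgebra) :=
  Order.POrder_MeetJoin_isLattice.Build con_display (con A)
    (@con_meetP A) (@con_joinP A).
HB.instance Definition _ (A : finAlgebra) :=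
  Order.hasBottom.Build con_display (con A) (@con_bottomP A).
HB.instance Definition _ (A : finAlgebra) :=
  Order.hasTop.Build con_display (con A) (@con_topP A).

Lemma con_leE (A : finAlgebra) (a b : con A) :
  (a <= b) = (con_set a \subset con_set b).
Proof. by []. Qed.

Lemma con_topE (A : finAlgebra) : con_set (\top : con A) = [set: A * A].
Proof. by rewrite /= big_pred0. Qed.

Lemma con_bottomE (A : finAlgebra) :
  con_set (\bot : con A) = [set p | p.1 == p.2].
Proof.
have idP : `[< is_congruence [set p : A * A | p.1 == p.2] >].
  apply/asboolP; split=> [x|x y|x y z|n f s t st]; rewrite ?inE //=.
  - by rewrite eq_sym.
  - by move=> /eqP->.
  - apply/eqP; congr (op A f _); apply: eq_from_tnth => i.
    by have := st i; rewrite inE => /eqP.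
apply/eqP; rewrite eqEsubset; apply/andP; split.
  exact: (con_bottomP (Con idP)).
apply/subsetP => -[x y]; rewrite inE /= => /eqP->.
by have [+ _ _ _] := conP (con_bottom A); apply.
Qed.

Lemma con_meetsE (A : finAlgebra) (P : pred (con A)) :
  con_set (\meet_(c : con A | P c) c) = \bigcap_(c : con A | P c) con_set c.
Proof.
suff -> : \meet_(c : con A | P c) c = con_inter P by [].
apply: le_anti; apply/andP; split; last by apply/meetsP => c; apply: con_inter_le.
by apply/con_le_inter => c Pc; apply: (@meets_inf _ (con A) _ c P id).
Qed.

Definition centralizes (A : finAlgebra) (alpha beta delta : con A) : Prop :=
  forall (n : nat) (t : term A n.+1) (a b : A) (c d : n.-tuple A),
    (a, b) \in con_set alpha ->
    (forall i, (tnth c i, tnth d i) \in con_set beta) ->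
    (eval t [tuple of a :: c], eval t [tuple of a :: d]) \in con_set delta ->
    (eval t [tuple of b :: c], eval t [tuple of b :: d]) \in con_set delta.

Definition commutator (A : finAlgebra) (alpha beta : con A) : con A :=
  \meet_(delta : con A | `[< centralizes alpha beta delta >]) delta.

(* With indices shifted by one: [lower_central A k] is lambda_(k+1). *)
Fixpoint lower_central (A : finAlgebra) (k : nat) : con A :=
  if k is k'.+1 then commutator \top (lower_central A k') else \top.

Definition nilpotent (A : finAlgebra) : Prop :=
  exists k, lower_central A k = \bot.

Definition lattice_iso (d1 d2 : Order.disp_t) (L1 : latticeType d1)
    (L2 : latticeType d2) : Prop :=
  exists f : L1 -> L2,
    [/\ bijective f,
        {morph f : x y / x `&` y >-> x `&` y} &
        {morph f : x y / x `|` y >-> x `|` y}].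

Definition forces (d : Order.disp_t) (L : latticeType d)
    (p K : finAlgebra -> Prop) : Prop :=
  forall A : finAlgebra, K A -> lattice_iso (con A) L -> p A.

Section LatticeNotions.
Variables (d : Order.disp_t) (L : finTBLatticeType d).
Implicit Types (alpha beta eta : L) (p q : L * L).

Definition prime_interval alpha beta : bool :=
  (alpha < beta) && ([set x | alpha <= x <= beta] == [set alpha; beta]).

Definition upper eta : L := \meet_(beta : L | eta < beta) beta.

Definition meet_irreducible eta : bool := eta < upper eta.

(* The pair [(alpha, beta)] stands for the interval I[alpha, beta].  Pairs with
   [~~ (alpha <= beta)] are related to no other pair, so that restricting
   [projective] to intervals changes nothing. *)
Definition transposes_up : rel (L * L) := fun p q =>
  (q.2 == p.2 `|` q.1) && (p.1 == p.2 `&` q.1).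

Definition projective : rel (L * L) :=
  connect (relU transposes_up (fun p q => transposes_up q p)).

Definition Gamma alpha beta : L :=
  \join_(eta : L | meet_irreducible eta
                   && projective (eta, upper eta) (alpha, beta)) eta.

End LatticeNotions.

(* Main.v *)
(* (3) => (2): a meet irreducible [eta] centralizes [eta^+] modulo [eta], and
   the centralizer of a prime interval is invariant under projectivity because
   congruences permute.  Hence [Gamma alpha beta] centralizes [beta] modulo
   [alpha]; if all of these are [1], every prime interval is central and the
   lower central series descends along a maximal chain.

   (2) => (3): let [A] be a finite expanded group with congruence lattice [L]
   and suppose [G := Gamma alpha beta < 1].  Let [D] be the meet of all
   congruences not below [G].  By modularity [D] lies above every join
   irreducible [c], with lower cover [r], such that [I[r, c]] is projective to
   [I[alpha, beta]]; thus no prime interval above [D] is projective to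
   [I[alpha, beta]].  The main step ([separation]) shows that there is then a
   congruence preserving function [e] on [A] with values in one class of [D]
   that does not collapse [c] into [r].  The binary function mapping [(x, y)]
   to [e o] if [x] is in the [G]-class of [o], and to [e y] otherwise, preserves
   all congruences.  Adding it to [A] keeps the congruence lattice and puts [c]
   below all terms of the lower central series. *)
Require Import Defs.
From mathcomp Require Import all_boot all_order.
From mathcomp Require Import boolp.

Set Implicit Arguments.
Unset Strict Implicit.
Unset Printing Implicit Defensive.

Import Order.TTheory.
Local Open Scope order_scope.

(** * Covers, join irreducibles and transposed intervals in finite lattices *)

Section FiniteLattices.
Variables (d : Order.disp_t) (L : finTBLatticeType d).
Implicit Types (x y a b c r : L) (p q : L * L).

Lemma prime_intervalP a b :
  reflect (a < b /\ forall x, a <= x -> x <= b -> x = a \/ x = b)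
          (prime_interval a b).
Proof.
apply: (iffP andP) => [[ab /eqP/setP E]|[ab E]]; split=> //.
  move=> x ax xb; move: (E x); rewrite !inE ax xb /=.
  by case/esym/orP => /eqP; [left|right].
apply/eqP/setP => x; rewrite !inE; apply/andP/orP.
  by case=> ax xb; case: (E x ax xb) => ->; rewrite eqxx; [left|right].
by case=> /eqP->; rewrite lexx (ltW ab).
Qed.

Lemma card_down_lt x y :
  x < y -> (#|[set z | (z <= x)%O]| < #|[set z | (z <= y)%O]|)%N.
Proof.
move=> xy; apply: proper_card; apply/properP; split.
  by apply/subsetP => z; rewrite !inE => /le_trans; apply; apply: ltW.
by exists y; rewrite !inE ?lexx // lt_geF.
Qed.

Lemma ex_minimal (P : pred L) a :
  P a -> exists2 c, c <= a & P c /\ forall x, x < c -> ~~ P x.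
Proof.
move=> Pa; pose Q := [pred x | P x && (x <= a)].
have Qa : Q a by rewrite /= Pa lexx.
case: (arg_minnP (fun x => #|[set z | (z <= x)%O]|) Qa) => c /andP[Pc ca] Hc.
exists c => //; split=> // x xc; apply/negP => Px.
have := card_down_lt xc; rewrite ltnNge Hc //=.
by rewrite Px (le_trans (ltW xc)).
Qed.

Lemma ex_maximal (P : pred L) a :
  P a -> exists2 c, a <= c & P c /\ forall x, c < x -> ~~ P x.
Proof.
move=> Pa; pose Q := [pred x | P x && (a <= x)].
have Qa : Q a by rewrite /= Pa lexx.
case: (arg_maxnP (fun x => #|[set z | (z <= x)%O]|) Qa) => c /andP[Pc ca] Hc.
exists c => //; split=> // x xc; apply/negP => Px.
have /= := Hc x; rewrite Px (le_trans ca (ltW xc)) => /(_ isT).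
by rewrite /= leqNgt card_down_lt.
Qed.

(** [r] is the unique lower cover of [c]; it is carried along since [(r, c)] is the prime interval
    that stands for [c]. *)
Definition join_irreducible_over r c : Prop :=
  r < c /\ forall x, x < c -> x <= r.

Lemma join_irreducible_meet r c x :
  join_irreducible_over r c -> ~~ (c <= x) -> c `&` x <= r.
Proof.
move=> [_ H] cx; apply: H; rewrite lt_neqAle leIl andbT.
by apply: contra cx => /eqP<-; apply: leIr.
Qed.

(** Take [c] minimal among the elements below [b] and not below [a]: whatever lies strictly below
    [c] is below [a], so the lower cover is the meet of [c] and [a]. *)
Lemma ex_join_irreducible a b : ~~ (b <= a) ->
  exists r c, [/\ join_irreducible_over r c, c <= b, ~~ (c <= a) & r <= a].
Proof.
case/(@ex_minimal (fun x => ~~ (x <= a))) => c cb [ca H].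
exists (c `&` a), c; split=> //; last exact: leIr.
split=> [|x xc].
  rewrite lt_neqAle leIl andbT.
  by apply: contra ca => /eqP<-; apply: leIr.
by rewrite lexI (ltW xc) -[X in is_true X]negbK H.
Qed.

Lemma ex_upper_cover a b : a < b ->
  exists2 c, a <= c & c < b /\ forall x, c < x -> x <= b -> x = b.
Proof.
case/(@ex_maximal (fun x => x < b)) => c ac [cb H]; exists c => //.
split=> // x /H xb xleb; apply/eqP; apply: contraNT xb => ne.
by rewrite lt_neqAle ne.
Qed.

Lemma projective_sym p q : projective p q = projective q p.
Proof. by apply: sym_connect_sym => u v /=; rewrite orbC. Qed.

Lemma transposes_projective p q : transposes_up p q -> projective p q.
Proof. by move=> pq; apply: connect1; rewrite /= pq. Qed.

(** Replaces a prime interval by that of a join irreducible: primality forces the join of [c] and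
    [a] to be [b], and join irreducibility forces their meet to be [r]. *)
Lemma transposes_join_irreducible a b r c : prime_interval a b ->
  c <= b -> ~~ (c <= a) -> join_irreducible_over r c -> r <= a ->
  transposes_up (r, c) (a, b).
Proof.
move=> /prime_intervalP[ab H] cb ca J ra; apply/andP; split; apply/eqP => /=.
  have [|||//] := H (c `|` a); first exact: leUr.
  - by rewrite leUx cb ltW.
  - by move=> E; case/negP: ca; rewrite -E leUl.
apply/eqP; rewrite eq_le lexI ra (ltW J.1) /=.
exact: join_irreducible_meet.
Qed.

Lemma Gamma_max a b eta : meet_irreducible eta ->
  projective (eta, upper eta) (a, b) -> eta <= Gamma a b.
Proof. by move=> mi pr; apply: joins_sup; rewrite mi. Qed.

End FiniteLattices.

(** * Invariance of the [Gamma] condition under lattice isomorphism *)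

Section LatticeIso.
Variables (d1 d2 : Order.disp_t).
Variables (L1 : finTBLatticeType d1) (L2 : finTBLatticeType d2).
Variables (f : L1 -> L2) (g : L2 -> L1).
Hypotheses (fK : cancel f g) (gK : cancel g f).
Hypothesis fI : {morph f : x y / x `&` y >-> x `&` y}.
Hypothesis fU : {morph f : x y / x `|` y >-> x `|` y}.

Lemma iso_le x y : (f x <= f y) = (x <= y).
Proof. by rewrite !leEmeet -fI (inj_eq (can_inj fK)). Qed.

Lemma iso_lt x y : (f x < f y) = (x < y).
Proof. by rewrite !lt_neqAle iso_le (inj_eq (can_inj fK)). Qed.

Lemma iso_prime_interval x y :
  prime_interval (f x) (f y) -> prime_interval x y.
Proof.
move=> /prime_intervalP[xy H]; apply/prime_intervalP; rewrite -iso_lt.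
split=> // z xz zy.
by have [||/(can_inj fK)|/(can_inj fK)] := H (f z); rewrite ?iso_le //;
   [left|right].
Qed.

Lemma iso_upper x : upper (f x) = f (upper x).
Proof.
apply/eqP; rewrite eq_le; apply/andP; split.
  rewrite -[X in X <= _]gK iso_le; apply/meetsP => y xy.
  by rewrite -iso_le gK; apply: meets_inf; rewrite iso_lt.
apply/meetsP => y xy; rewrite -[y]gK iso_le; apply: meets_inf.
by rewrite -iso_lt gK.
Qed.

Lemma iso_projective p q :
  projective p q -> projective (f p.1, f p.2) (f q.1, f q.2).
Proof.
case/connectP => s; elim: s p => [|u s IH] p /=.
  by move=> _ ->; apply: connect0.
case/andP=> pu us /(IH u us); apply: connect_trans; apply: connect1 => /=.
by case/orP: pu => /andP[/eqP e1 /eqP e2]; apply/orP; [left|right];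
   rewrite /transposes_up /= e1 e2 fU fI !eqxx.
Qed.

Lemma iso_Gamma_top :
  (forall a b : L1, prime_interval a b -> Gamma a b = \top) ->
  forall a b : L2, prime_interval a b -> Gamma a b = \top.
Proof.
move=> H a b ab; apply/eqP; rewrite -le1x -[Gamma a b]gK -[\top]gK iso_le.
apply: (@le_trans _ _ \top); first exact: lex1.
rewrite -(H (g a) (g b)); last by apply: iso_prime_interval; rewrite !gK.
apply/joinsP => eta /andP[mi pr]; rewrite -iso_le gK; apply: Gamma_max.
  by rewrite /meet_irreducible iso_upper iso_lt.
by have := iso_projective pr; rewrite /= !gK iso_upper.
Qed.

End LatticeIso.

Lemma lattice_iso_sym d1 d2 (L1 : latticeType d1) (L2 : latticeType d2) :
  lattice_iso L1 L2 -> lattice_iso L2 L1.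
Proof.
case=> f [[g fK gK] fI fU]; exists g; split; first by exists f.
  by move=> x y; apply: (can_inj fK); rewrite fI !gK.
by move=> x y; apply: (can_inj fK); rewrite fU !gK.
Qed.

Lemma lattice_iso_trans d1 d2 d3 (L1 : latticeType d1) (L2 : latticeType d2)
    (L3 : latticeType d3) :
  lattice_iso L1 L2 -> lattice_iso L2 L3 -> lattice_iso L1 L3.
Proof.
case=> f [bf fI fU] [g [bg gI gU]]; exists (g \o f); split.
- exact: bij_comp.
- by move=> x y /=; rewrite fI gI.
- by move=> x y /=; rewrite fU gU.
Qed.

Lemma lattice_iso_Gamma_top d1 d2 (L1 : finTBLatticeType d1)
    (L2 : finTBLatticeType d2) :
  lattice_iso L1 L2 ->
  (forall a b : L1, prime_interval a b -> Gamma a b = \top) ->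
  forall a b : L2, prime_interval a b -> Gamma a b = \top.
Proof. by case=> f [[g fK gK] fI fU]; apply: iso_Gamma_top fK gK fI fU. Qed.

(** * Congruences and functions preserving them *)

Local Notation cong t x y := ((x, y) \in con_set t).

Section Congruences.
Variable A : finAlgebra.
Implicit Types (t u a b c r mu nu : con A) (x y z : A).

Lemma cong_refl t x : cong t x x.
Proof. by have [+ _ _ _] := conP t; apply. Qed.

Lemma cong_sym t x y : cong t x y -> cong t y x.
Proof. by have [_ + _ _] := conP t; apply. Qed.

Lemma cong_trans t y x z : cong t x y -> cong t y z -> cong t x z.
Proof. by have [_ _ + _] := conP t; apply. Qed.

Lemma con_op t n (f : sym A n) (v w : n.-tuple A) :
  (forall i, cong t (tnth v i) (tnth w i)) -> cong t (op A f v) (op A f w).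
Proof. by have [_ _ _ +] := conP t; apply. Qed.

Lemma con_leP t u :
  reflect (forall x y, cong t x y -> cong u x y) (t <= u).
Proof. by apply: (iffP subsetP) => [H x y|H [x y]]; apply: H. Qed.

Lemma cong_le t u x y : t <= u -> cong t x y -> cong u x y.
Proof. by move/con_leP; apply. Qed.

Lemma con_nleP t u :
  ~~ (t <= u) -> exists x y, cong t x y /\ ~~ cong u x y.
Proof. by case/subsetPn => -[x y] txy uxy; exists x, y. Qed.

Lemma con_meetE t u x y : cong (t `&` u) x y = cong t x y && cong u x y.
Proof.
apply/idP/andP => [H|[tx ux]].
  by split; apply: cong_le H; [apply: leIl|apply: leIr].
by apply/bigcapP => c /orP[]/eqP->.
Qed.

Lemma con_top_cong x y : cong (\top : con A) x y.
Proof. by rewrite con_topE inE. Qed.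

Lemma con_bot_cong x y : cong (\bot : con A) x y -> x = y.
Proof. by rewrite con_bottomE inE => /eqP. Qed.

(** Only congruences below [mu] are tested, which makes induction on [mu] possible; for [\top] this
    is congruence preservation. *)
Definition preserves mu (g : A -> A) : Prop :=
  forall t, t <= mu -> forall x y, cong t x y -> cong t (g x) (g y).

Definition kills (g : A -> A) (p : con A * con A) : Prop :=
  forall x y, cong p.2 x y -> cong p.1 (g x) (g y).

Definition maps_into mu (g : A -> A) : Prop :=
  forall x y, cong mu (g x) (g y).

Lemma preserves_comp mu (g h : A -> A) :
  preserves mu g -> preserves mu h -> preserves mu (g \o h).
Proof. by move=> pg ph t tmu x y txy; apply: pg => //; apply: ph. Qed.

Lemma preserves_le mu nu (g : A -> A) :
  mu <= nu -> preserves nu g -> preserves mu g.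
Proof. by move=> le pg t tmu; apply: pg; apply: le_trans le. Qed.

Lemma not_killsP (g : A -> A) a b :
  ~ kills g (a, b) -> exists x y, cong b x y /\ ~~ cong a (g x) (g y).
Proof.
move=> H; apply: contrapT => N; apply: H => x y /= bxy.
by apply: contrapT => /negP ?; apply: N; exists x, y.
Qed.

End Congruences.

(** * Mal'cev operations, permuting congruences and modularity *)

Definition malcev (A : finAlgebra) (m : A -> A -> A -> A) : Prop :=
  [/\ forall x y, m x y y = x, forall x y, m x x y = y &
      forall (t : con A) x x' y y' z z', cong t x x' -> cong t y y' ->
        cong t z z' -> cong t (m x y z) (m x' y' z')].

Lemma expanded_group_malcev (A : finAlgebra) :
  expanded_group A -> exists m : A -> A -> A -> A, malcev m.
Proof.
case=> add [opp [zero [addA add0 addr0 addN addrN]]].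
pose plus x y := op A add [tuple x; y]; pose neg x := op A opp [tuple x].
(* The operation is x - y + z. *)
exists (fun x y z => plus x (plus (neg y) z)); split.
- by move=> x y; rewrite /plus addN addr0.
- by move=> x y; rewrite /plus addA addrN add0.
have plus_cong (t : con A) x x' y y' :
    cong t x x' -> cong t y y' -> cong t (plus x y) (plus x' y').
  by move=> tx ty; apply: con_op => -[[|[|]]].
have neg_cong (t : con A) x x' : cong t x x' -> cong t (neg x) (neg x').
  by move=> tx; apply: con_op => -[[|]].
move=> t x x' y y' z z' tx ty tz.
exact: plus_cong (tx) (plus_cong _ _ _ _ _ (neg_cong _ _ _ ty) tz).
Qed.

Section Permuting.
Variables (A : finAlgebra) (m : A -> A -> A -> A) (mP : malcev m).
Implicit Types (t u a b c r mu nu : con A) (x y z : A).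

Lemma malcevl x y : m x x y = y. Proof. by case: mP. Qed.
Lemma malcevr x y : m x y y = x. Proof. by case: mP. Qed.
Lemma malcev_cong t x x' y y' z z' : cong t x x' -> cong t y y' ->
  cong t z z' -> cong t (m x y z) (m x' y' z').
Proof. by case: mP => _ _; apply. Qed.

Lemma con_permute t u x y z : cong t x y -> cong u y z ->
  exists2 w, cong u x w & cong t w z.
Proof.
move=> txy uyz; exists (m x y z).
  by rewrite -{1}[x](malcevr x y); apply: malcev_cong; rewrite ?cong_refl.
rewrite -{2}[z](malcevl y z); apply: malcev_cong; rewrite ?cong_refl //.
Qed.

Lemma con_join_cong t u x y :
  cong (t `|` u) x y <-> exists2 z, cong t x z & cong u z y.
Proof.
(* The relational product is a congruence because [t] and [u] permute, hence it is the join. *)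
pose s := [set xy : A * A | [exists z, cong t xy.1 z && cong u z xy.2]].
have inS x1 y1 : (x1, y1) \in s <-> exists2 z, cong t x1 z & cong u z y1.
  by rewrite inE; split=> [/existsP[z /andP[]]|[z tz uz]];
     [exists z | apply/existsP; exists z; rewrite tz].
have sP : `[< is_congruence s >].
  apply/asboolP; split=> [x1|x1 y1|x1 y1 z1|n f v w H].
  - by apply/inS; exists x1; apply: cong_refl.
  - case/inS => z tz uz; apply/inS.
    by have [w tw uw] := con_permute (cong_sym uz) (cong_sym tz); exists w.
  - case/inS => w tw uw /inS[w' tw' uw']; apply/inS.
    have [w1 tw1 uw1] := con_permute uw tw'.
    by exists w1; [apply: cong_trans tw1|apply: cong_trans uw'].
  - have {}H i : exists z, cong t (tnth v i) z && cong u z (tnth w i).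
      by have /inS[z tz uz] := H i; exists z; rewrite tz.
    apply/inS; exists (op A f [tuple xchoose (H i) | i < n]);
      apply: con_op => i; rewrite tnth_mktuple;
      by have /andP[] := xchooseP (H i).
have le : t `|` u <= Con sP.
  rewrite leUx; apply/andP; split; apply/con_leP => x1 y1 H; apply/inS.
    by exists y1 => //; apply: cong_refl.
  by exists x1 => //; apply: cong_refl.
split=> [/(cong_le le)/inS //|[z tz uz]].
by apply: (@cong_trans _ _ z); [apply: cong_le tz|apply: cong_le uz];
  rewrite ?leUl ?leUr.
Qed.

Lemma con_modular a b c : a <= c -> (a `|` b) `&` c <= a `|` (b `&` c).
Proof.
move=> ac; apply/con_leP => x y; rewrite con_meetE => /andP[/con_join_cong].
case=> z az bz cxy; apply/con_join_cong; exists z => //; rewrite con_meetE bz.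
by apply: cong_trans cxy; apply: cong_sym; apply: cong_le az.
Qed.

(** This is the congruence generated by [(x, y)], described by all congruence preserving functions
    in place of unary polynomials. The Mal'cev operation reverses and chains the image pairs, giving
    symmetry and transitivity. *)
Lemma principal_con x y : exists t : con A, forall x' y',
  cong t x' y' <-> exists g, [/\ preserves \top g, g x = x' & g y = y'].
Proof.
pose P x' y' := exists g : A -> A, [/\ preserves \top g, g x = x' & g y = y'].
pose s := [set xy : A * A | `[< P xy.1 xy.2 >]].
have inS x1 y1 : (x1, y1) \in s <-> P x1 y1.
  by rewrite inE; split=> /asboolP.
have sP : `[< is_congruence s >].
  apply/asboolP; split=> [x1|x1 y1|x1 y1 z1|n f v w H].
  - by apply/inS; exists (fun=> x1); split=> // t _ *; apply: cong_refl.
  - case/inS => g [pg gx gy]; apply/inS.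
    exists (fun z => m x1 (g z) y1); split; rewrite ?gx ?gy.
    + by move=> t le z z' tz; apply: malcev_cong; rewrite ?cong_refl ?pg.
    + exact: malcevl.
    + exact: malcevr.
  - case/inS => g [pg gx gy] /inS[h [ph hx hy]]; apply/inS.
    exists (fun z => m (g z) y1 (h z)); split; rewrite ?gx ?gy ?hx ?hy.
    + by move=> t le z z' tz; apply: malcev_cong; rewrite ?cong_refl ?pg ?ph.
    + exact: malcevr.
    + exact: malcevl.
  - have /choice[g gP] i : P (tnth v i) (tnth w i) by apply/inS.
    apply/inS; exists (fun z => op A f [tuple g i z | i < n]); split.
    + move=> t le z z' tz; apply: con_op => i; rewrite !tnth_mktuple.
      by case: (gP i) => pg _ _; apply: pg.
    + congr (op A f _); apply: eq_from_tnth => i; rewrite tnth_mktuple.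
      by case: (gP i).
    + congr (op A f _); apply: eq_from_tnth => i; rewrite tnth_mktuple.
      by case: (gP i).
by exists (Con sP) => x' y'; apply: inS.
Qed.

(** A pair in [b'] factors through a pair in [b] and one in [a'], and [g] preserves [a']. Conversely
    [g] preserves [b], so pairs sent into [a'] land in the meet [a]. *)
Lemma transposes_up_kills mu (g : A -> A) a b a' b' :
  preserves mu g -> b' <= mu -> transposes_up (a, b) (a', b') ->
  kills g (a, b) <-> kills g (a', b').
Proof.
move=> pg le /andP[/eqP /= eb' /eqP /= ea]; subst; split=> H x y /=.
  case/con_join_cong => z bxz azy; apply: (@cong_trans _ _ (g z)).
    by have := H x z bxz; rewrite con_meetE => /andP[].
  by apply: pg azy; apply: le_trans le; apply: leUr.
move=> bxy; rewrite con_meetE; apply/andP; split.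
  by apply: pg bxy; apply: le_trans le; apply: leUl.
by apply: H; apply: cong_le bxy; apply: leUl.
Qed.

(* Projectivity alone does not suffice: a chain of transposes may leave
   [I[\bot, mu]], where a function preserving the congruences below [mu] need
   not respect it. *)
Definition linked mu (p q : con A * con A) : Prop :=
  projective p q /\
  forall g, preserves mu g -> (kills g p <-> kills g q).

Lemma linked_refl mu p : linked mu p p.
Proof. by split=> //; apply: connect0. Qed.

Lemma linked_sym mu p q : linked mu p q -> linked mu q p.
Proof.
by case=> pr H; split=> [|g /H]; [rewrite projective_sym|case].
Qed.

Lemma linked_trans mu p q s : linked mu p q -> linked mu q s -> linked mu p s.
Proof.
case=> pr1 H1 [pr2 H2]; split=> [|g pg]; first exact: connect_trans pr1 pr2.
exact: iff_trans (H1 g pg) (H2 g pg).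
Qed.

Lemma linked_le mu nu p q : mu <= nu -> linked mu p q -> linked nu p q.
Proof.
by move=> le [pr H]; split=> // g pg; apply: H; apply: preserves_le pg.
Qed.

Lemma transposes_up_linked mu a b a' b' :
  b' <= mu -> transposes_up (a, b) (a', b') -> linked mu (a, b) (a', b').
Proof.
move=> le tr; split=> [|g pg]; first exact: transposes_projective.
exact: transposes_up_kills pg le tr.
Qed.

End Permuting.

(** * Separating join irreducibles by congruence preserving functions *)

Section Separation.
Variables (A : finAlgebra) (m : A -> A -> A -> A) (mP : malcev m).
Implicit Types (t u a b c r mu nu : con A) (x y z o p v : A).

Definition class_retraction mu o : A -> A :=
  fun z => if cong mu z o then z else o.

(** A pair in a congruence below [mu] never straddles the case distinction. *)
Lemma class_retractionP mu o (e := class_retraction mu o) :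
  [/\ preserves mu e, e o = o, forall z, cong mu (e z) o &
      forall z, cong mu z o -> e z = z].
Proof.
rewrite /e /class_retraction; split=> [t tmu y z tyz||z|z].
- have muyz : cong mu y z by apply: cong_le tyz.
  have -> : cong mu z o = cong mu y o.
    by apply/idP/idP; apply: cong_trans => //; apply: cong_sym.
  by case: ifP => // _; apply: cong_refl.
- by rewrite cong_refl.
- by case: ifP => // _; apply: cong_refl.
- by move=> ->.
Qed.

(** Otherwise, starting from the retraction to the [mu]-class of [o], composition with separating
    functions moves the elements of [A] one by one into the [nu]-class of [o], keeping the image of
    [x] outside its [r]-class. The result maps into [nu] without killing [(r, c)]. *)
Lemma inseparable_pair mu nu r c x o : nu <= mu -> c <= mu ->
  cong c x o -> ~~ cong r x o ->
  (forall e, preserves mu e -> maps_into nu e -> kills e (r, c)) ->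
  exists v w, [/\ cong mu v o, ~~ cong nu v o, cong c w o, ~~ cong r w o &
    forall g, preserves mu g -> g o = o -> cong nu (g v) o -> cong r (g w) o].
Proof.
move=> numu cmu cxo rxo Hkill; apply: contrapT => N.
have step v w : cong mu v o -> ~~ cong nu v o -> cong c w o -> ~~ cong r w o ->
    exists g, [/\ preserves mu g, g o = o, cong nu (g v) o & ~~ cong r (g w) o].
  move=> muv nuv cw rw; apply: contrapT => N'; apply: N.
  exists v, w; split=> //.
  move=> g pg go nug; apply: contrapT => /negP rg; apply: N'.
  by exists g; split.
have all_into (s : seq A) : exists e : A -> A,
    [/\ preserves mu e, e o = o, forall z, cong mu (e z) o,
        ~~ cong r (e x) o & forall z, z \in s -> cong nu (e z) o].
  elim: s => [|z s [e [pe eo emu er es]]].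
    have [pe eo emu efix] := class_retractionP mu o.
    by exists (class_retraction mu o); split=> //; rewrite efix ?(cong_le cmu).
  have [nuz|nuz] := boolP (cong nu (e z) o).
    by exists e; split=> // z'; rewrite inE => /predU1P[->|/es].
  have cex : cong c (e x) o by rewrite -{1}eo; apply: pe.
  have [g [pg go nug rg]] := step _ _ (emu z) nuz cex er.
  exists (g \o e); split=> //=.
  - exact: preserves_comp.
  - by rewrite eo.
  - by move=> z'; rewrite -{1}go; apply: pg.
  - move=> z'; rewrite inE => /predU1P[->//|/es nue].
    by rewrite -{1}go; apply: pg.
have [e [pe eo _ er es]] := all_into (enum A).
have enu z : cong nu (e z) o by apply: es; rewrite mem_enum.
case/negP: er; rewrite -{1}eo; apply: (Hkill e) => //.
by move=> y z; apply: cong_trans (cong_sym (enu z)).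
Qed.

(* Moving [v] into the class of [o] modulo [c'], let [t] be the congruence
   generated by [r], [r'] and the pair [(v - o + p, o)].  Inseparability gives
   [(p, o)] outside [t], so that [t] is the diagonal of an M3 between
   [I[r, c]] and [I[r', c']] and both transpose up to [I[t, c `|` c']]. *)
Lemma inseparable_linked mu nu r c r' c' v p o :
  nu <= mu -> (forall t, nu < t -> t <= mu -> t = mu) ->
  join_irreducible_over r c -> c <= nu ->
  join_irreducible_over r' c' -> r' <= nu -> c' <= mu -> ~~ (c' <= nu) ->
  cong mu v o -> ~~ cong nu v o -> cong c p o -> ~~ cong r p o ->
  (forall g, preserves mu g -> g o = o -> cong nu (g v) o -> cong r (g p) o) ->
  ~~ (c <= c') -> linked mu (r, c) (r', c').
Proof.
move=> numu cover J cnu J' r'nu c'mu c'nu muvo nuvo cpo rpo insep cc'.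
have cmu : c <= mu by apply: le_trans numu.
have rc : r <= c by apply: ltW J.1.
have rc' : r' <= c' by apply: ltW J'.1.
have emu : nu `|` c' = mu.
  apply: cover; last by rewrite leUx numu.
  by rewrite lt_def leUl andbT joinC -leEjoin.
wlog c'vo : v muvo nuvo insep / cong c' v o.
  have /(con_join_cong mP)[w nuvw c'wo] : cong (nu `|` c') v o by rewrite emu.
  move=> W; apply: (W w) => //.
  - exact: cong_le c'wo.
  - by apply: contra nuvo; apply: cong_trans nuvw.
  - move=> g pg go nug; apply: insep => //.
    by apply: cong_trans nug; apply: pg.
pose q := m v o p.
have c'qp : cong c' q p.
  rewrite /q -{2}[p](malcevl mP o).
  by apply: (malcev_cong mP); rewrite ?cong_refl.
have cqv : cong c q v.
  rewrite /q -{2}[v](malcevr mP v o).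
  by apply: (malcev_cong mP); rewrite ?cong_refl.
have [s sP] := principal_con mP q o.
pose t := s `|` (r' `|` r).
have sqo : cong s q o by apply/sP; exists id; split.
have tqo : cong t q o by apply: cong_le sqo; apply: leUl.
have scc' : s <= c `|` c'.
  apply/con_leP => x y /sP[g [pg <- <-]]; apply: pg; first exact: lex1.
  by apply/(con_join_cong mP); exists v.
have cc'mu : c `|` c' <= mu by rewrite leUx cmu.
have tpo : ~~ cong t p o.
  apply: contra rpo => /(con_join_cong mP)[_ /sP[g0 [pg0 e1 <-]] rr].
  (* Here [g0] sends [q] to [p] and [o] to an element congruent to [o] modulo the join of [r'] and
     [r]. Correcting it to fix [o] makes the inseparability of [v] and [p] applicable. *)
  pose g z := m (g0 z) (g0 o) o.
  have pg : preserves \top g.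
    by move=> t' le x y txy; apply: (malcev_cong mP); rewrite ?cong_refl ?pg0.
  have go : g o = o by apply: (malcevl mP).
  have : cong (r' `|` r) (g q) p.
    rewrite /g e1 -{2}[p](malcevr mP p o).
    by apply: (malcev_cong mP); rewrite ?cong_refl.
  case/(con_join_cong mP) => u r'u rup.
  have ru : cong r (g p) u.
    apply: (cong_le (join_irreducible_meet J cc')); rewrite con_meetE.
    have cup : cong c u p by apply: cong_le rup.
    have cgp : cong c (g p) o by rewrite -{1}go; apply: pg => //; apply: lex1.
    rewrite (cong_trans cgp (cong_sym (cong_trans cup cpo))) /=.
    apply: cong_trans (cong_le rc' r'u).
    by apply: pg (cong_sym c'qp); apply: lex1.
  have rgp : cong r (g p) o.
    apply: insep => //; first by apply: preserves_le pg; apply: lex1.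
    have nugq : cong nu (g v) (g q).
      by apply: pg; [apply: lex1|apply: cong_le cnu (cong_sym cqv)].
    apply: cong_trans nugq _; apply: cong_trans (cong_le r'nu r'u) _.
    by apply: (cong_le cnu); apply: cong_trans cpo; apply: cong_le rup.
  by apply: cong_trans rgp; apply: cong_sym; apply: cong_trans ru rup.
have ct : ~~ (c <= t) by apply: contra tpo => /cong_le; apply.
have c't : ~~ (c' <= t).
  apply: contra tpo => le; apply: cong_trans tqo.
  by apply: cong_sym; apply: cong_le c'qp.
have rt : r <= t by rewrite lexU2 // leUr orbT.
have r't : r' <= t by rewrite lexU2 // leUl orbT.
have tcc' : t <= c `|` c'.
  by rewrite !leUx scc' (le_trans rc (leUl _ _)) (le_trans rc' (leUr _ _)).
(* If [c'] were not below the join of [c] and [t], their meet would be below [r'], hence below [nu];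
   but it contains [(v, o)] by way of [q]. For [top2] the pair is [(p, o)]. *)
have top1 : c `|` t = c `|` c'.
  apply/eqP; rewrite eq_le leUx leUl tcc' leUx leUl /=; apply: contraT => N.
  case/negP: nuvo; apply: (cong_le r'nu).
  apply: (cong_le (join_irreducible_meet J' N)).
  rewrite con_meetE c'vo; apply/(con_join_cong mP); exists q => //.
  exact: cong_sym.
have top2 : c' `|` t = c `|` c'.
  apply/eqP; rewrite eq_le leUx leUr tcc' leUx leUl /= andbT.
  apply: contraT => N.
  case/negP: rpo; apply: (cong_le (join_irreducible_meet J N)).
  rewrite con_meetE cpo; apply/(con_join_cong mP); exists q => //.
  exact: cong_sym.
have tr1 : transposes_up (r, c) (t, c `|` c').
  rewrite /transposes_up /= top1 eqxx eq_le lexI rt ltW ?J.1 //=.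
  exact: join_irreducible_meet.
have tr2 : transposes_up (r', c') (t, c `|` c').
  rewrite /transposes_up /= top2 eqxx eq_le lexI r't ltW ?J'.1 //=.
  exact: join_irreducible_meet.
apply: linked_trans (transposes_up_linked mP cc'mu tr1) _.
exact: linked_sym (transposes_up_linked mP cc'mu tr2).
Qed.

(* Induction on [mu], with [nu < mu] reduced to a lower cover [k] of [mu].  If
   no function into [k] separates [c] from [r] and nothing linked to [I[r, c]]
   lies outside [nu], then by [inseparable_linked] every join irreducible
   linked to [c] is below every join irreducible not below [k], hence below
   their meet [mu0].  A congruence [t <= mu] satisfies either [mu0 <= t] or
   [t <= mu1 <= k], so functions on [mu1] with values in [mu0] preserve all
   congruences below [mu], and the induction hypothesis for [mu1] applies. *)
Lemma separation mu nu r c :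
  join_irreducible_over r c -> c <= mu -> nu <= mu ->
  (exists e, [/\ preserves mu e, maps_into nu e & ~ kills e (r, c)]) \/
  (exists r' c', [/\ join_irreducible_over r' c', c' <= mu, ~~ (c' <= nu) &
                     linked mu (r, c) (r', c')]).
Proof.
have [n] := ubnP #|[set z | z <= mu]|.
elim: n mu nu r c => // n IH mu nu r c lemu J cmu numu.
have ltr a b : join_irreducible_over a b -> ~~ (b <= a).
  by case=> ab _; rewrite lt_geF.
have [->|ne] := eqVneq nu mu.
  have [x [o [cxo rxo]]] := con_nleP (ltr _ _ J).
  have [pe eo emu efix] := class_retractionP mu o.
  left; exists (class_retraction mu o); split=> //.
    by move=> y z; apply: cong_trans (emu y) (cong_sym (emu z)).
  by move=> /(_ x o cxo) /=; rewrite eo efix ?(cong_le cmu cxo) // (negPf rxo).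
have numu' : nu < mu by rewrite lt_neqAle ne.
have [k nuk [kmu cover]] := ex_upper_cover numu'.
have IHk lam : lam <= k -> (#|[set z | (z <= lam)%O]| < n)%N.
  move=> lamk; rewrite -ltnS; apply: leq_trans lemu; rewrite ltnS.
  by apply: card_down_lt; apply: le_lt_trans kmu.
have [ck|ck] := boolP (c <= k); last first.
  right; exists r, c; split=> //; last exact: linked_refl.
  by apply: contra ck => /le_trans; apply.
have [[e1 [pe1 e1k Ke1]]|N] := pselect (exists e1,
    [/\ preserves mu e1, maps_into k e1 & ~ kills e1 (r, c)]).
  have [[e2 [pe2 e2nu Ke2]]|[r' [c' [J' c'k c'nu lnk]]]] :=
      IH k nu r c (IHk _ (lexx k)) J ck nuk; last first.
    right; exists r', c'; split=> //; first by apply: le_trans (ltW kmu).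
    by apply: linked_le lnk; apply: ltW.
  left; have [x [y [cxy re]]] := not_killsP Ke1.
  have [a [b [cab re2]]] := not_killsP Ke2.
  (* The pair [(e1 x, e1 y)] generates a congruence above [c], so some [g] carries it to the pair
     [(a, b)] that [e2] separates; the function sought is the composite. *)
  have [s sP] := principal_con mP (e1 x) (e1 y).
  have cs : c <= s.
    apply: contraT => /(join_irreducible_meet J) crs; case/negP: re.
    apply: (cong_le crs); rewrite con_meetE (pe1 c) //=.
    by apply/sP; exists id; split.
  have [g [pg ga gb]] : exists g,
      [/\ preserves \top g, g (e1 x) = a & g (e1 y) = b].
    by apply/sP; apply: cong_le cab.
  exists (e2 \o g \o e1); split=> [t tmu z z' tz|z z'|H] /=.
  (* The values of [e1] lie in one [k]-class, so [e2] need only respect the meet of [t] and [k]. *)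
  - apply: (@cong_le _ (t `&` k)); first exact: leIl.
    apply: pe2; first exact: leIr.
    apply: pg; first exact: lex1.
    by rewrite con_meetE e1k andbT; apply: pe1.
  - exact: e2nu.
  - by have := H x y cxy; rewrite /= ga gb (negPf re2).
right; apply: contrapT => N'.
have kill e : preserves mu e -> maps_into k e -> kills e (r, c).
  by move=> pe ek; apply: contrapT => Ke; apply: N; exists e.
have lnk_nu r' c' : join_irreducible_over r' c' -> c' <= mu ->
    linked mu (r, c) (r', c') -> c' <= nu.
  by move=> J' c'mu lnk; apply: contraT => c'nu; case: N'; exists r', c'.
have comparable r1 c1 r2 c2 : join_irreducible_over r1 c1 -> c1 <= mu ->
    linked mu (r, c) (r1, c1) -> join_irreducible_over r2 c2 -> r2 <= k ->
    c2 <= mu -> ~~ (c2 <= k) -> c1 <= c2.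
  move=> J1 c1mu lnk1 J2 r2k c2mu c2k; apply: contraT => c12.
  have c1k : c1 <= k by apply: le_trans nuk; apply: lnk_nu lnk1.
  have [x [o [cxo rxo]]] := con_nleP (ltr _ _ J1).
  have [|v [p [muv kv cp rp insep]]] := inseparable_pair (ltW kmu) c1mu cxo rxo.
    by move=> e pe ek; apply/lnk1.2 => //; apply: kill.
  have lnk2 := inseparable_linked (ltW kmu) cover J1 c1k J2 r2k c2mu c2k
    muv kv cp rp insep c12.
  by case/negP: c2k; apply: le_trans (lnk_nu _ _ J2 c2mu _) nuk;
    apply: linked_trans lnk2.
pose P c2 := [&& `[< exists2 r2, join_irreducible_over r2 c2 & r2 <= k >],
                 c2 <= mu & ~~ (c2 <= k)].
pose mu0 := mu `&` \meet_(c2 | P c2) c2.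
pose mu1 := \join_(t | (t <= mu) && ~~ (mu0 <= t)) t.
have below t : t <= mu -> ~~ (mu0 <= t) -> t <= k.
  move=> tmu; apply: contraR => /ex_join_irreducible[r2 [c2 [J2 c2t c2k r2k]]].
  apply: le_trans (leIr _ _) _; apply: le_trans (c2t); apply: meets_inf.
  by rewrite /P c2k (le_trans c2t) // !andbT; apply/asboolP; exists r2.
have mu1k : mu1 <= k by apply/joinsP => t /andP[]; apply: below.
have le_mu0 r1 c1 : join_irreducible_over r1 c1 -> c1 <= mu ->
    linked mu (r, c) (r1, c1) -> c1 <= mu0.
  move=> J1 c1mu lnk1; rewrite lexI c1mu; apply/meetsP => c2.
  by case/and3P=> /asboolP[r2 J2 r2k] ? ?; apply: (comparable r1 _ r2).
have mu0I : mu0 `&` mu1 <= mu0 by apply: leIl.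
have mu0k : mu0 `&` mu1 <= k by apply: le_trans (leIr _ _) mu1k.
have pres_mu e : preserves mu1 e -> maps_into mu0 e -> preserves mu e.
  move=> pe emu0 t tmu x y txy.
  have [mu0t|mu0t] := boolP (mu0 <= t); first exact: cong_le mu0t (emu0 x y).
  by apply: pe txy; apply: joins_sup; rewrite tmu.
(* By induction at [mu1], either a function into [mu0] contradicts [kill], or a linked join
   irreducible escapes [mu0], against [le_mu0]. *)
have [cmu1|cmu1] := boolP (c <= mu1).
  have [[e [pe ee Ke]]|[r' [c' [J' c'mu1 c'n lnk]]]] :=
      IH mu1 (mu0 `&` mu1) r c (IHk _ mu1k) J cmu1 (leIr _ _).
    apply: Ke; apply: kill => [|x y]; last exact: cong_le mu0k (ee x y).
    by apply: pres_mu pe _ => x y; apply: cong_le mu0I (ee x y).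
  have mu1mu : mu1 <= mu by apply: le_trans (ltW kmu).
  case/negP: c'n; rewrite lexI c'mu1 andbT; apply: le_mu0 J' _ _.
    exact: le_trans mu1mu.
  exact: linked_le lnk.
have [x1 [o1 [cx1 mu1x1]]] := con_nleP cmu1.
have [x [o [cxo rxo]]] := con_nleP (ltr _ _ J).
have cmu0 : c <= mu0 by apply: le_mu0 J cmu (linked_refl _ _).
have mu0c : mu0 <= c.
  by apply: contraT => ?; case/negP: cmu1; apply: joins_sup; rewrite cmu.
(* Constant on [mu1]-classes, with both values in one [c]-class, hence in one class of [mu0]; it
   sends [(x1, o1)] to [(o, x)] up to order, so it does not kill [(r, c)]. *)
pose e z := if cong mu1 z o1 then o else x.
have ec : maps_into c e.
  by move=> y z; rewrite /e; case: ifP; case: ifP; rewrite ?cong_refl // => _ _;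
    apply: cong_sym.
case/negP: rxo; have := @kill e _ _ x1 o1 cx1.
rewrite /e /= cong_refl (negPf mu1x1); apply.
  apply: pres_mu => [t tmu1 y z tyz|y z]; last exact: cong_le (ec y z).
  have muyz : cong mu1 y z by apply: cong_le tyz.
  rewrite /e; have -> : cong mu1 z o1 = cong mu1 y o1.
    by apply/idP/idP; apply: cong_trans => //; apply: cong_sym.
  exact: cong_refl.
by move=> y z; apply: cong_le (ec y z).
Qed.

End Separation.

(** * Centralizers, projectivity and nilpotency *)

Section Nilpotency.
Variables (A : finAlgebra) (m : A -> A -> A -> A) (mP : malcev m).
Implicit Types (t u a b c r mu nu eta : con A) (x y z : A).

Lemma centralizes_le_right eta b b' a :
  b' <= b -> centralizes eta b a -> centralizes eta b' a.
Proof.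
move=> le C n t x y v w exy bvw; apply: C => // i.
exact: cong_le le (bvw i).
Qed.

Lemma centralizes_join eta eta' b a : centralizes eta b a ->
  centralizes eta' b a -> centralizes (eta `|` eta') b a.
Proof.
move=> C C' n t x y v w /(con_join_cong mP)[z exz ezy] bvw H.
by apply: (C' n t z y v w) => //; apply: (C n t x z v w).
Qed.

Lemma centralizes_bottom b a : centralizes \bot b a.
Proof. by move=> n t x y v w /con_bot_cong->. Qed.

Lemma eval_cong t n (s : term A n) (v w : n.-tuple A) :
  (forall i, cong t (tnth v i) (tnth w i)) -> cong t (eval s v) (eval s w).
Proof.
move=> H; elim: s => [i|k f ts IH] /=; first exact: H.
by apply: con_op => i; rewrite !tnth_mktuple.
Qed.

Lemma eval_cons_cong t n (s : term A n.+1) x y (v w : n.-tuple A) :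
  cong t x y -> (forall i, cong t (tnth v i) (tnth w i)) ->
  cong t (eval s [tuple of x :: v]) (eval s [tuple of y :: w]).
Proof.
move=> txy H; apply: eval_cong => i.
by have [j ->|->] := unliftP ord0 i; rewrite ?tnthS // !tnth0.
Qed.

Lemma centralizes_refl eta b : centralizes eta b eta.
Proof.
move=> n s x y v w exy bvw H.
have E (z : n.-tuple A) :
      cong eta (eval s [tuple of x :: z]) (eval s [tuple of y :: z]).
  by apply: eval_cons_cong => // i; apply: cong_refl.
exact: cong_trans (cong_sym (E v)) (cong_trans H (E w)).
Qed.

(** By permutability each pair in [b'] splits into a pair in [b] and one in [a']; the second part is
    invisible modulo [a']. Pairs in [b] give values congruent modulo [b], where [a'] and [a]
    agree. *)
Lemma transposes_up_centralizes eta a b a' b' :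
  transposes_up (a, b) (a', b') ->
  centralizes eta b a <-> centralizes eta b' a'.
Proof.
case/andP=> /eqP /= eb' /eqP /= ea; subst; split=> C n s x y v w exy bvw H.
  have {}bvw i : exists z, cong b (tnth v i) z && cong a' z (tnth w i).
    by have /(con_join_cong mP)[z bz az] := bvw i; exists z; rewrite bz.
  pose z := [tuple xchoose (bvw i) | i < n].
  have bz i : cong b (tnth v i) (tnth z i).
    by rewrite tnth_mktuple; have /andP[] := xchooseP (bvw i).
  have az x' : cong a' (eval s [tuple of x' :: z]) (eval s [tuple of x' :: w]).
    apply: eval_cons_cong => [|i]; first exact: cong_refl.
    by rewrite tnth_mktuple; have /andP[] := xchooseP (bvw i).
  apply: cong_trans (az y); apply: (@cong_le _ (b `&` a')); first exact: leIr.
  apply: (C _ _ _ _ _ _ exy bz); rewrite con_meetE; apply/andP; split.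
    exact: (eval_cons_cong s (cong_refl b x) bz).
  exact: cong_trans H (cong_sym (az x)).
rewrite con_meetE; apply/andP; split.
  exact: (eval_cons_cong s (cong_refl b y) bvw).
apply: C exy _ _ => [i|]; first by apply: cong_le (bvw i); apply: leUl.
by apply: cong_le H; apply: leIr.
Qed.

Lemma projective_centralizes eta p q : projective p q ->
  centralizes eta p.2 p.1 <-> centralizes eta q.2 q.1.
Proof.
case/connectP=> s; elim: s p => [|u s IH] p /=; first by move=> _ ->.
case/andP=> pu us /(IH u us); apply: iff_trans.
case/orP: pu; case: p u {us} => a b [a' b'];
  move/transposes_up_centralizes => /(_ eta) //.
exact: iff_sym.
Qed.

Lemma centralizes_Gamma a b : centralizes (Gamma a b) b a.
Proof.
apply: (big_ind (fun eta => centralizes eta b a)).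
- exact: centralizes_bottom.
- by move=> eta eta'; apply: centralizes_join.
- move=> eta /andP[_ pr].
  by apply/(projective_centralizes eta pr); apply: centralizes_refl.
Qed.

Lemma commutator_le eta b a : centralizes eta b a -> commutator eta b <= a.
Proof. by move=> C; apply: meets_inf; apply/asboolP. Qed.

Lemma Gamma_top_nilpotent :
  (forall a b : con A, prime_interval a b -> Gamma a b = \top) -> nilpotent A.
Proof.
move=> H.
have descend n (b : con A) k : (#|[set z | (z <= b)%O]| < n)%N ->
    lower_central A k <= b -> nilpotent A.
  elim: n b k => // n IH b k lt kb.
  have [b0|b0] := eqVneq b \bot.
    by exists k; apply/eqP; rewrite -lex0 -b0.
  have [|a _ [ab cover]] := @ex_upper_cover _ (con A) \bot b.
    by rewrite lt0x.
  apply: (IH a k.+1).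
    by rewrite -ltnS; apply: leq_trans lt; rewrite ltnS; apply: card_down_lt.
  (* Since [Gamma a b] is [\top], the next term of the series drops below the lower cover [a] of
     [b]. *)
  apply: commutator_le; apply: centralizes_le_right kb _.
  rewrite -(H a b); first exact: centralizes_Gamma.
  apply/prime_intervalP; split=> // x ax xb.
  have [->|ne] := eqVneq x a; [by left|right].
  by apply: cover => //; rewrite lt_def ne.
exact: (descend _ \top 0 (ltnSn _)).
Qed.

(** If [c] is not below [t], modularity keeps it from being below the join of [r] and [t]. A maximal
    [eta] above that join and not above [c] is meet irreducible, and [(r, c)] transposes up to
    [(eta, upper eta)], so [t] is below [Gamma a b]. *)
Lemma projective_join_irreducible_le_Gamma a b r c t :
  join_irreducible_over r c -> projective (r, c) (a, b) ->
  ~~ (t <= Gamma a b) -> c <= t.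
Proof.
move=> J pr; apply: contraR => ct.
have ctr : ~~ (c <= r `|` t).
  apply/negP => le; have : c <= r; last by rewrite (lt_geF J.1).
  have : c <= r `|` (t `&` c).
    by apply: le_trans (con_modular mP _ (ltW J.1)); rewrite lexI le lexx.
  by move/le_trans; apply; rewrite leUx lexx meetC join_irreducible_meet.
have [eta le [ceta H]] := @ex_maximal _ _ (fun u : con A => ~~ (c <= u)) _ ctr.
have up : upper eta = c `|` eta.
  apply/eqP; rewrite eq_le; apply/andP; split.
    by apply: meets_inf; rewrite lt_def leUr andbT -leEjoin.
  apply/meetsP => x ex; rewrite leUx (ltW ex) andbT.
  by rewrite -[X in is_true X]negbK H.
apply: le_trans (le_trans (leUr _ _) le) _; apply: Gamma_max.
  by rewrite /meet_irreducible up lt_def leUr andbT -leEjoin.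
apply: connect_trans pr; rewrite -/(projective _ _) projective_sym.
apply: transposes_projective; rewrite /transposes_up /= up eqxx /=.
rewrite eq_le lexI (ltW J.1) (le_trans (leUl _ _) le) /=.
exact: join_irreducible_meet.
Qed.

End Nilpotency.

(** * Expansion by a congruence preserving binary operation *)

Section Expansion.
Variables (A : finAlgebra) (f : A -> A -> A) (o : A).

(* The operation [f] is added in every arity (reading the missing arguments as
   [o]), which makes the expansion uniform in the arity. *)
Definition expansion : finAlgebra := FinAlgebra
  (sym := fun n => option (sym A n))
  (fun n s v => if s is Some s' then op A s' v else f (nth o v 0) (nth o v 1)).

Lemma expanded_group_expansion : expanded_group A -> expanded_group expansion.
Proof.
by case=> add [opp [zero H]]; exists (Some add), (Some opp), (Some zero).
Qed.

Hypothesis f_cong : forall (t : con A) x x' y y',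
  cong t x x' -> cong t y y' -> cong t (f x y) (f x' y').

Lemma expansion_congruence (t : {set A * A}) :
  @is_congruence expansion t <-> @is_congruence A t.
Proof.
split=> -[tr ts tt top]; split=> // n s; first exact: (top n (Some s)).
have tP : `[< @is_congruence A t >] by apply/asboolP.
case: s => [s|] v w H; first exact: top.
have nth_cong i : (nth o v i, nth o w i) \in t.
  have [lt|le] := ltnP i n; last by rewrite !nth_default ?size_tuple.
  by have := H (Ordinal lt); rewrite !(tnth_nth o).
by apply: (@f_cong (Con tP)); apply: nth_cong.
Qed.

Definition to_expansion (t : con A) : con expansion :=
  @Con expansion t (asboolT ((expansion_congruence t).2 (conP t))).

Definition of_expansion (t : con expansion) : con A :=
  @Con A t (asboolT ((expansion_congruence t).1 (conP t))).

Lemma cong_of_expansion (t : con expansion) (x y : A) :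
  cong (of_expansion t) x y = cong t x y.
Proof. by []. Qed.

Lemma con_expansion_iso : lattice_iso (con expansion) (con A).
Proof.
have toK : cancel to_expansion of_expansion by move=> t; apply: val_inj.
have ofK : cancel of_expansion to_expansion by move=> t; apply: val_inj.
have mono : {mono of_expansion : t u / t <= u} by [].
exists of_expansion; split; first by exists to_expansion.
- move=> t u; apply/eqP; rewrite eq_le lexI !mono leIl leIr /=.
  by rewrite -[X in X <= _]toK mono lexI -!mono toK leIl leIr.
- move=> t u; apply/eqP; rewrite eq_le leUx !mono leUl leUr andbT.
  by rewrite -[X in _ <= X]toK mono leUx -!mono toK leUl leUr.
Qed.

End Expansion.

(** * A non-nilpotent expansion, and the equivalence *)

Lemma forcing_Gamma_top (A : finAlgebra) : expanded_group A ->
  (forall B : finAlgebra, expanded_group B -> lattice_iso (con B) (con A) ->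
     nilpotent B) ->
  forall a b : con A, prime_interval a b -> Gamma a b = \top.
Proof.
move=> Agrp Hnil a b ab; apply/eqP; apply: contraT => Gtop.
have [m mP] := expanded_group_malcev Agrp.
pose G := Gamma a b; pose D := \meet_(t : con A | ~~ (t <= G)) t.
have [r [c [J cb ca ra]]] : exists r c, [/\ join_irreducible_over r c, c <= b,
    ~~ (c <= a) & r <= a].
  apply: ex_join_irreducible.
  by case/prime_intervalP: ab => ab _; rewrite lt_geF.
have pr := transposes_projective (transposes_join_irreducible ab cb ca J ra).
have [[e [pe eD Ke]]|[r' [c' [J' _ c'D [pr' _]]]]] :=
    separation mP J (lex1 c) (lex1 D); last first.
  case/negP: c'D; apply/meetsP => t.
  apply: (projective_join_irreducible_le_Gamma mP J').
  by rewrite projective_sym in pr'; apply: connect_trans pr' pr.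
have [x [y [cxy rexy]]] := not_killsP Ke.
have [w [o [_ Gwo]]] : exists w o, cong (\top : con A) w o /\ ~~ cong G w o.
  by apply: con_nleP; rewrite le1x.
(* Congruences [t <= G] cannot see the case distinction, and all others lie
   above [D], which contains the values of [e]. *)
pose f u v := if cong G u o then e o else e v.
have f_cong (t : con A) u u' v v' :
    cong t u u' -> cong t v v' -> cong t (f u v) (f u' v').
  move=> tu tv; have [tG|tG] := boolP (t <= G).
    have -> : f u' v' = if cong G u o then e o else e v'.
      rewrite /f; congr (if _ then _ else _).
      by apply/idP/idP; apply: cong_trans; [|apply: cong_sym];
        apply: cong_le tu.
    by rewrite /f; case: ifP => _; [apply: cong_refl|apply: pe tv; apply: lex1].
  apply: (@cong_le _ D); first exact: meets_inf.
  by rewrite /f; case: ifP; case: ifP => _ _; apply: eD.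
have [k lk] :=
  Hnil _ (expanded_group_expansion f o Agrp) (con_expansion_iso o f_cong).
have c_le k' :
    c <= of_expansion (o := o) f_cong (lower_central (expansion f o) k').
  elim: k' => [|k' IH].
    by apply/con_leP => u v _; rewrite cong_of_expansion; apply: con_top_cong.
  apply/subsetP => p cp; rewrite con_meetsE; apply/bigcapP => t /asboolP C.
  (* Test the centralizer condition on [f]: [f o x] and [f o y] both equal [e o], so replacing [o]
     by [w] puts [(e x, e y)] into [t]. This pair is in [c] but not in [r]. *)
  have rt : ~~ (c `&` of_expansion (o := o) f_cong t <= r).
    apply: contra rexy => /cong_le; apply; rewrite con_meetE.
    rewrite (pe c (lex1 c)) //=.
    (* In arity 2 the added symbol [None] is [f] itself. *)
    pose s : term (expansion f o) 2 :=
      @App (expansion f o) 2 2 None (fun i => Var _ i).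
    have ev u (v : 1.-tuple A) :
        @eval (expansion f o) 2 s [tuple of u :: v] = f u (tnth v ord0).
      by rewrite /= !enum_ordSl /= tnth0 tnthS.
    have := C 1 s o w [tuple x] [tuple y]
      (con_top_cong (A := expansion f o) _ _).
    rewrite !ev /f cong_refl (negPf Gwo) => H; apply: H => [i|]; last first.
      exact: cong_refl.
    rewrite ord1; exact: (cong_le IH cxy).
  have ct : c <= of_expansion (o := o) f_cong t.
    by apply: contraT => /(join_irreducible_meet J); rewrite (negPf rt).
  by case: p cp => u v; apply: cong_le ct.
case/negP: rexy; suff -> : x = y by apply: cong_refl.
have := cong_le (c_le k) cxy; rewrite cong_of_expansion lk.
exact: (con_bot_cong (A := expansion f o)).
Qed.

Theorem theorem1p3 (d : Order.disp_t) (L : finTBLatticeType d)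
    (L_con : exists A : finAlgebra, expanded_group A /\ lattice_iso (con A) L) :
  [<-> forces L nilpotent expanded_group;
       forall B : finAlgebra, expanded_group B -> lattice_iso (con B) L ->
         nilpotent B;
       forall alpha beta : L, prime_interval alpha beta ->
         Gamma alpha beta = \top].
Proof.
have [A [Agrp isoA]] := L_con.
tfae=> [//|H|H B Bgrp isoB].
  apply: (lattice_iso_Gamma_top isoA).
  apply: forcing_Gamma_top => // B Bgrp isoB.
  exact: H Bgrp (lattice_iso_trans isoB isoA).
have [m mP] := expanded_group_malcev Bgrp.
apply: (Gamma_top_nilpotent mP); apply: lattice_iso_Gamma_top H.
exact: lattice_iso_sym.
Qed.
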